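(* Let $C$ be a nonempty convex subset of $X$, let $F\colon X\to Y\cup\{+\infty_Y\}$ be a proper $K$-convex mapping, and let $G\colon X\to Z\cup\{+\infty_Z\}$ be a proper $S$-convex mapping. Let $A:=C\cap G^{-1}(-S)$ and $E:=G(C\cap\operatorname{dom}F\cap\operatorname{dom}G)+S$. Assume that $A\cap\operatorname{dom}F\neq\emptyset$ and that one of the following conditions holds: $(c_1)$ there exists $\bar x\in C\cap\operatorname{dom}F$ such that $G(\bar x)\in-\operatorname{int}S$; $(c_2)$ $X,Z$ are Fréchet spaces, $C$ is closed, $y^*\circ F$ is lower semicontinuous for all $y^*\in Y^*$, $G$ is $S$-epi closed and $0_Z\in\operatorname{sqri}E$; $(c_3)$ $\dim\operatorname{lin}E<+\infty$ and $0_Z\in\operatorname{ri}E$. Then for all $(L,y)\in\mathcal{L}(X,Y)\times Y$ the following assertions are equivalent: $(b_1)$ for all $x$: if $x\in C$ and $G(x)\in-S$, then $F(x)-L(x)+y\notin-\operatorname{int}K$; $(b_3)$ there exists $T\in\mathcal{L}_+^w(S,K)$ such that $F(x)+(T\circ G)(x)-L(x)+y\notin T(-S)-\operatorname{int}K$ for all $x\in C$.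
   Context: $X,Y,Z$ are (real) locally convex Hausdorff topological vector spaces with topological duals $X^*,Y^*,Z^*$; $K\subset Y$ is a closed, pointed, convex cone with $\operatorname{int}K\neq\emptyset$; $S\subset Z$ is a nonempty closed convex cone. $Y$ is enlarged by a greatest element $+\infty_Y\notin Y$ and a smallest element $-\infty_Y\notin Y$, $Y^\bullet:=Y\cup\{-\infty_Y,+\infty_Y\}$, with $(+\infty_Y)+y=y+(+\infty_Y)=+\infty_Y$ for $y\in Y\cup\{+\infty_Y\}$ (so $+\infty_Y$ belongs to no subset of $Y$). Analogously $+\infty_Z$ is a greatest element attached to $Z$ (ordered by $S$). For $F\colon X\to Y^\bullet$, $\operatorname{dom}F=\{x\in X: F(x)\neq+\infty_Y\}$; $F$ is proper if $\operatorname{dom}F\neq\emptyset$ and $-\infty_Y\notin F(X)$; $\operatorname{epi}_KF=\{(x,y)\in X\times Y: y\in F(x)+K\}$; $F$ is $K$-convex if $\operatorname{epi}_KF$ is convex, and $K$-epi closed if it is closed. The same notions are used for $G$ with $(Z,S)$ in place of $(Y,K)$. For $y^*\in Y^*$, $(y^*\circ F)(x)=y^*(F(x))$ if $F(x)\in Y$ and $+\infty$ if $F(x)=+\infty_Y$. $\mathcal{L}(X,Y)$ is the space of continuous linear mappings $X\to Y$. For $T\in\mathcal{L}(Z,Y)$, $(T\circ G)(x)=T(G(x))$ if $G(x)\in Z$ and $+\infty_Y$ if $G(x)=+\infty_Z$. $\mathcal{L}_+^w(S,K)=\{T\in\mathcal{L}(Z,Y): T(S)\cap(-\operatorname{int}K)=\emptyset\}$.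 For a convex set $U$: $\operatorname{lin}U$ is its linear hull, $\operatorname{ri}U$ its relative interior (interior relative to its affine hull), and $\operatorname{sqri}U$ its strong quasi-relative interior, i.e. the set of $u\in U$ such that the cone $\bigcup_{\lambda\ge 0}\lambda(U-u)$ is a closed linear subspace. *)

(* Defs.v *)
From HB Require Import structures.
From mathcomp Require Import all_boot all_order all_algebra.
From mathcomp Require Import all_classical all_reals all_analysis.
Import Order.TTheory GRing.Theory Num.Theory.
Import numFieldNormedType.Exports.

Set Implicit Arguments.
Unset Strict Implicit.
Unset Printing Implicit Defensive.

Local Open Scope classical_set_scope.
Local Open Scope ring_scope.

(* A locally convex space is a [tvsType R]. The enlargement of a space Y by
   -oo and +oo is the type [\bar Y], whose addition [adde] satisfies
   +oo + y = y + +oo = +oo for y <> -oo (the sum of +oo and -oo, which is -oo in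
   the library, never occurs for proper mappings). A subset A of Y, seen inside
   [\bar Y], is [EFin @` A]. The composite of a linear map T with a mapping F
   valued in [\bar Y] is [er_map T \o F], since [er_map T] maps +oo to +oo. *)

Section algebra_of_sets.
Context (R : realType) (V : lmodType R).
Implicit Types A U : set V.

Definition opp_set A : set V := [set - a | a in A].

Definition add_set A U : set V := [set a + u | a in A & u in U].

Definition cone A := forall (l : R) a, 0 <= l -> A a -> A (l *: a).

Definition convex_cone A := cone A /\ convex_set A.

Definition pointed A := A `&` opp_set A = [set 0].

Definition linear_subspace A :=
  A 0 /\ forall (l : R) a b, A a -> A b -> A (l *: a + b).

Definition affine_subspace A :=
  forall (t : R) a b, A a -> A b -> A ((1 - t) *: a + t *: b).

Definition linear_hull U : set V := smallest linear_subspace U.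

Definition affine_hull U : set V := smallest affine_subspace U.

Definition finite_dimensional A :=
  exists2 B : set V, finite_set B & A = linear_hull B.

(* The cone generated by U - u. *)
Definition cone_at U (u : V) : set V :=
  [set l *: (v - u) | l in [set l : R | 0 <= l] & v in U].

End algebra_of_sets.

Section topology_of_sets.
Context (R : realType) (E : tvsType R).
Implicit Types U : set E.

(* Interior for the topology induced on the affine hull: in the library,
   [subspace A] puts on the carrier of E a topology which, on A, is the induced
   one, and which makes every point outside A isolated; as U is contained in
   its affine hull, those points play no role. *)
Definition ri U : set E := @interior (subspace (affine_hull U)) U.

Definition sqri U : set E :=
  [set u | [/\ U u, closed (cone_at U u) & linear_subspace (cone_at U u)]].

(* A locally convex space is Frechet if its topology is given by a complete
   translation-invariant metric. The library's [completeType] and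
   [countable_uniformity] are not usable here, because the uniform structure
   packed in a [tvsType] only has to induce the topology: it need not be the
   translation-invariant one. *)
Definition frechet_space :=
  exists d : E -> E -> R,
    [/\ [/\ forall x y, 0 <= d x y,
            forall x y, d x y = 0 <-> x = y,
            forall x y, d x y = d y x
          & forall x y z, d x z <= d x y + d y z],
        forall x y z, d (x + z) (y + z) = d x y,
        forall x, nbhs x =
          filter_from [set e : R | 0 < e] (fun e => [set y | d x y < e])
      & forall u : nat -> E,
          (forall e : R, 0 < e -> exists N, forall m n,
            (N <= m)%N -> (N <= n)%N -> d (u m) (u n) < e) ->
          exists l : E, u @ \oo --> l].

End topology_of_sets.

Section vector_mappings.
Context (R : realType) (X Y : tvsType R).
Implicit Types (K : set Y) (F : X -> \bar Y).

Definition dom F : set X := [set x | F x <> +oo%E].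

Definition is_proper F := dom F !=set0 /\ ~ range F -oo%E.

Definition epi K F : set (X * Y) :=
  [set p | exists2 k, K k & p.2%:E = (F p.1 + k%:E)%E].

Definition K_convex K F :=
  convex_set (epi K F : set (convex_lmodType (X * Y)%type)).

Definition K_epi_closed K F := closed (epi K F).

(* The set L_+^w(S, K). *)
Definition weakly_positive (S : set X) K : set {linear X -> Y} :=
  [set T | continuous T /\ T @` S `&` opp_set (interior K) = set0].

End vector_mappings.

(* Main.v *)
Require Import Defs.
From HB Require Import structures.
From mathcomp Require Import all_boot all_order all_algebra.
From mathcomp Require Import ring lra.
From mathcomp Require Import all_classical all_reals all_analysis.
Import Order.TTheory GRing.Theory Num.Theory.
Import numFieldNormedType.Exports.

(** The implication from the multiplier T to the optimality condition is a
substitution: if G x = - s then F x - L x + y = - k becomes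
F x + T (G x) - L x + y = T (- s) - k.

Conversely, the set P of the values of F - L + y on the feasible set, enlarged
by K, is convex and misses - int K, so that some continuous linear form f on Y,
nonnegative on K and with f k0 = 1 at a point k0 of int K, is nonnegative on P
([positive_separation]). The vector problem thereby becomes the scalar
convex program of minimizing f (F x - L x + y) over x in C subject to
G x in - S, whose value is nonnegative. Its perturbation set M
consists of the pairs (z, r) for which some x in C satisfies z in G x + S and
f (F x - L x + y) <= r; it is convex, projects onto E, and has a nonnegative
fibre over 0. A continuous linear form g on Z lying below M
(g z <= r for (z, r) in M) is a Lagrange multiplier up to sign: it is
nonpositive on S, and T z = - g z *: k0 is the required mapping, because
f (T z) = - g z.

The form g is where the qualification conditions enter. Algebraically it comes
from a Hahn-Banach theorem for convex sets of pairs
([convex_linear_minorant]), which only needs that the cone generated by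
the domain be a subspace. Continuity is the point. By
[continuous_linear_minorant] it is enough that the value function be bounded
above, by a constant, near 0 in a linear subspace W containing E.

- Under (c1), W = Z and the bound is the objective value at the Slater point.
- Under (c2), W is the cone generated by E, and the bound is the openness theorem
  of Robinson and Ursescu for a closed convex relation between Frechet spaces
  ([robinson_ursescu]): Baire's theorem makes the closure of the range of small
  pieces a neighbourhood of 0 in W, and a geometric series of corrections removes
  the closure.
- Under (c3), no boundedness is needed: an algebraic form below M can be
  replaced by a continuous form which agrees with it on a finite spanning
  family ([continuous_linear_interpolation]), as continuous forms separate
  the points of a Hausdorff locally convex space. *)

Set Implicit Arguments.
Unset Strict Implicit.
Unset Printing Implicit Defensive.

Local Open Scope classical_set_scope.
Local Open Scope ring_scope.

(** * Convex sets and linear forms *)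

Lemma convex_setP (R : realType) (V : lmodType R) (A : set V) :
  convex_set A <->
  forall x y (t : R), 0 <= t <= 1 -> A x -> A y -> A (t *: x + (1 - t) *: y).
Proof.
split=> [cA x y t /andP[t0 t1] Ax Ay|cA x y t /set_mem Ax /set_mem Ay].
  have it : Itv.spec (Itv.num_sem (R := R)) (Itv.Real `[0%Z, 1%Z]) t.
    by rewrite /= /Itv.num_sem/= num_real /= in_itv/= t0.
  by have := cA _ _ (Itv.mk it) (mem_set Ax) (mem_set Ay); rewrite inE.
by apply/mem_set; apply: cA => //; rewrite ge0 le1.
Qed.

Lemma convex_setD (R : realType) (V : lmodType R) (A : set V) (a b : R) x y :
  convex_set A -> 0 < a -> 0 < b -> A x -> A y ->
  exists2 z, A z & a *: x + b *: y = (a + b) *: z.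
Proof.
move=> /convex_setP cA a0 b0 Ax Ay; have ab0 : 0 < a + b by rewrite addr_gt0.
exists ((a / (a + b)) *: x + (1 - a / (a + b)) *: y).
  apply: cA => //; rewrite divr_ge0 ?(ltW a0) ?(ltW ab0)//= ler_pdivrMr// mul1r.
  by rewrite lerDl ltW.
rewrite scalerDr !scalerA; congr (_ *: _ + _ *: _).
  by rewrite mulrC divfK ?gt_eqF.
by rewrite mulrBr mulr1 mulrC divfK ?gt_eqF// addrC addKr.
Qed.

Lemma convex_set_oo (R : realType) (V : lmodType R) (A : set V) :
  (forall x y (t : R), 0 < t < 1 -> A x -> A y -> A (t *: x + (1 - t) *: y)) ->
  convex_set A.
Proof.
move=> cA; apply/convex_setP => x y t /andP[t0 t1] Ax Ay.
have [->|tn0] := eqVneq t 0; first by rewrite scale0r subr0 scale1r add0r.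
have [->|tn1] := eqVneq t 1; first by rewrite subrr scale0r scale1r addr0.
by apply: cA => //; rewrite !lt_neqAle t0 t1 eq_sym tn0 tn1.
Qed.

Lemma le_add_mul_eps (R : realType) (a b c : R) :
  (forall t, 0 < t -> a <= b + t * c) -> a <= b.
Proof.
move=> h; apply/ler_addgt0Pr => e e0.
have c0 : 0 < Num.max c 1 by rewrite lt_max ltr01 orbT.
have cc : c <= Num.max c 1 by rewrite le_max lexx.
have := h (e / Num.max c 1); rewrite divr_gt0// => /(_ isT) /le_trans; apply.
by rewrite lerD2l mulrAC ler_pdivrMr// ler_pM2l.
Qed.

Lemma linear_subspaceZ (R : realType) (V : lmodType R) (W : set V) (t : R) z :
  linear_subspace W -> W z -> W (t *: z).
Proof. by move=> [W0 lW] Wz; rewrite -[_ *: z]addr0; exact: lW. Qed.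

Lemma linear_subspaceT (R : realType) (V : lmodType R) :
  linear_subspace [set: V].
Proof. by []. Qed.

Lemma linear_formZ (R : realType) (V : lmodType R) (f : {linear V -> R^o})
    (k : R) z : f (k *: z) = k * f z.
Proof. by rewrite linearZ. Qed.

(** * Hahn-Banach theorem for cones and convex sets of pairs *)

Section hahn_banach.
Context (R : realType) (V : lmodType R).
Implicit Types (Q M : set (V * R^o)) (p q : V * R^o).

(** The cones of pairs handled by the Zorn argument. Symmetry of the domain (the
fourth clause) keeps the set of admissible values at a point of the domain
bounded below, while allowing domains that are not the whole space. *)
Definition minorizable_cone Q :=
  [/\ Q 0,
      forall p q, Q p -> Q q -> Q (p + q),
      forall t p, 0 < t -> Q p -> Q (t *: p),
      forall p, Q p -> exists r, Q (- p.1, r)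
    & forall r, Q (0, r) -> 0 <= r].

Lemma minorizable_cone_setU_chain Q (F : set (set (V * R^o))) :
  minorizable_cone Q ->
  F `<=` [set X | minorizable_cone (Q `|` X)] -> total_on F subset ->
  minorizable_cone (Q `|` \bigcup_(X in F) X).
Proof.
move=> gQ gF totF.
have sub X : F X -> Q `|` X `<=` Q `|` \bigcup_(X in F) X.
  by move=> FX p [Qp|Xp]; [left|right; exists X].
have mem p : (Q `|` \bigcup_(X in F) X) p ->
    exists2 X, X = set0 \/ F X & (Q `|` X) p.
  move=> [Qp|[X FX Xp]]; first by exists set0; [left|left].
  by exists X; [right|right].
have mem2 X : X = set0 \/ F X ->
    minorizable_cone (Q `|` X) /\ Q `|` X `<=` Q `|` \bigcup_(X in F) X.
  move=> [->|FX]; last by split; [exact: gF|exact: sub].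
  by split; [rewrite setU0|rewrite setU0; left].
have tot X Y : X = set0 \/ F X -> Y = set0 \/ F Y -> X `<=` Y \/ Y `<=` X.
  move=> [->|FX]; first by left.
  by move=> [->|FY]; [right|exact: totF].
split.
- by left; case: gQ.
- move=> p q /mem[X FX Xp] /mem[Y FY Yq].
  have [XY|YX] := tot _ _ FX FY.
    have [[_ add _ _ _]] := mem2 _ FY; apply; apply: add => //.
    by case: Xp => [?|/XY]; [left|right].
  have [[_ add _ _ _]] := mem2 _ FX; apply; apply: add => //.
  by case: Yq => [?|/YX]; [left|right].
- move=> t p t0 /mem[X FX Xp]; have [[_ _ sc _ _]] := mem2 _ FX; apply.
  exact: sc.
- move=> p /mem[X FX Xp]; have [[_ _ _ sy _] sX] := mem2 _ FX.
  by have [r Xr] := sy _ Xp; exists r; exact: sX.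
- by move=> r /mem[X FX Xp]; have [[_ _ _ _ pos] _] := mem2 _ FX; exact: pos.
Qed.

(** The line through (z, a) can be added as soon as a lies between the values of
Q at z and the opposites of its values at - z: over 0, the new elements are
then nonnegative by homogeneity. *)
Lemma minorizable_cone_extension Q z (a : R) :
  minorizable_cone Q ->
  (forall r, Q (z, r) -> a <= r) -> (forall r, Q (- z, r) -> - a <= r) ->
  minorizable_cone [set p + t *: ((z, a) : V * R^o) | p in Q & t in [set: R]].
Proof.
move=> [Q0 add sc sy pos] az aNz; split.
- by exists 0 => //; exists 0 => //; rewrite scale0r addr0.
- move=> _ _ [p Qp [s _ <-]] [q Qq [t _ <-]]; exists (p + q); first exact: add.
  by exists (s + t) => //; rewrite scalerDl addrACA.
- move=> t _ t0 [p Qp [s _ <-]]; exists (t *: p); first exact: sc.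
  by exists (t * s) => //; rewrite scalerDr scalerA.
- move=> _ [p Qp [s _ <-]]; have [r Qr] := sy _ Qp.
  exists (r - s * a); exists (- p.1, r) => //; exists (- s) => //.
  by congr pair => /=; rewrite ?opprD scaleNr.
- move=> r [[v b] Qp [s _ [/= vz <-]]].
  have {}vz : v = - (s *: z) by apply/eqP; rewrite -addr_eq0 vz.
  have [s0|s0|s0] := ltgtP s 0.
  + have : Q (z, (- s)^-1 * b).
      have := sc (- s)^-1 _ _ Qp; rewrite invr_gt0 oppr_gt0 => /(_ s0).
      rewrite vz -scaleNr; congr Q; congr pair => /=.
      by rewrite scalerA mulVf ?scale1r// oppr_eq0 lt_eqF.
    move=> /az; rewrite ler_pdivlMl ?oppr_gt0// => ?.
    by rewrite -[s *: a]/(s * a); lra.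
  + have : Q (- z, s^-1 * b).
      have := sc s^-1 _ _ Qp; rewrite invr_gt0 => /(_ s0).
      rewrite vz; congr Q; congr pair => /=.
      by rewrite scalerN scalerA mulVf ?scale1r// gt_eqF.
    move=> /aNz; rewrite ler_pdivlMl// => ?.
    by rewrite -[s *: a]/(s * a); lra.
  + move: Qp; rewrite vz s0 scale0r oppr0 => /pos b0.
    by rewrite scale0r addr0.
Qed.

(** A maximal cone contains the graph of a linear form and lies above it: by
maximality it contains the whole line through (z, a), where a is the infimum of
its values at z.
Working with cones of pairs instead of partial linear maps makes the upper
bound of a chain a mere union. *)
Lemma cone_linear_minorant Q : minorizable_cone Q ->
  exists f : {linear V -> R^o}, forall p, Q p -> f p.1 <= p.2.
Proof.
move=> gQ.
have [X [gX maxX]] := Zorn_bigcup (fun F => @minorizable_cone_setU_chain Q F gQ).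
set A := Q `|` X in gX.
have [A0 add sc sy pos] := gX.
have ext z a : (forall r, A (z, r) -> a <= r) ->
    (forall r, A (- z, r) -> - a <= r) -> A (z, a) /\ A (- z, - a).
  move=> az aNz; have := minorizable_cone_extension gX az aNz.
  set B := [set _ | _ in _ & _ in _] => gB.
  have AB : A `<=` B.
    by move=> p Ap; exists p => //; exists 0 => //; rewrite scale0r addr0.
  have BX : B `<=` X.
    apply: contrapT => nBX; apply: (maxX B).
      by split=> // p Xp; apply: AB; right.
    by rewrite /= setUidr// => p Qp; apply: AB; left.
  split; right; apply: BX; exists 0 => //.
    by exists 1 => //; rewrite scale1r add0r.
  by exists (-1) => //; rewrite scaleN1r add0r.
have /choice[f Af] z : exists a, A (z, a) /\ A (- z, - a).
  (* Outside the domain any value is admissible. *)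
  have [[r Azr]|nA] := pselect (exists r, A (z, r)); last first.
    exists 0; apply: ext => r Ar; exfalso; apply: nA; first by exists r.
    by have [s] := sy _ Ar; rewrite /= opprK; exists s.
  have [s ANzs] := sy _ Azr.
  have lb u v : A (z, u) -> A (- z, v) -> - v <= u.
    move=> Au Av; have := add _ _ Au Av.
    rewrite [_ + _](_ : _ = (0, u + v)) => [/pos|]; first lra.
    by congr pair; rewrite /= subrr.
  have hlb : has_lbound [set r | A (z, r)].
    by exists (- s) => u Au; exact: lb ANzs.
  exists (inf [set r | A (z, r)]); apply: ext => u Au; first exact: ge_inf.
  by rewrite lerNl; apply: lb_le_inf; [exists r|move=> v /lb; exact].
have fle z r : A (z, r) -> f z <= r.
  move=> Azr; have := add _ _ Azr (Af z).2.
  rewrite [_ + _](_ : _ = (0, r - f z)) => [/pos|]; first lra.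
  by congr pair; rewrite /= subrr.
have fge z r : A (- z, - r) -> r <= f z.
  move=> Azr; have := add _ _ Azr (Af z).1.
  rewrite [_ + _](_ : _ = (0, - r + f z)) => [/pos|]; first lra.
  by congr pair; rewrite /= addNr.
have Aline t z : A (t *: z, t * f z).
  have [t0|t0|->] := ltgtP t 0; last by rewrite scale0r mul0r.
    have := sc (- t) _ _ (Af z).2; rewrite oppr_gt0 => /(_ t0).
    by congr A; congr pair; rewrite /= scaleNr scalerN opprK.
  exact: (sc t _ t0 (Af z).1).
have flin : linear f.
  move=> t z w; apply/eqP; rewrite eq_le; apply/andP; split.
    by apply: fle; exact: (add _ _ (Aline t z) (Af w).1).
  apply: fge; have := add _ _ (Aline (- t) z) (Af w).2.
  by congr A; congr pair; rewrite /= ?scaleNr ?mulNr opprD.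
pose L := GRing.isLinear.Build R V R^o *:%R f flin.
pose fL : {linear V -> R^o} := HB.pack f L.
by exists fL => -[z r] Qp; apply: fle; left.
Qed.

End hahn_banach.

(** Hahn-Banach for a convex set of pairs, obtained by passing to the cone that
it generates. The hypothesis on directions says that this cone projects onto a
subspace, i.e. that 0 is in the relative algebraic interior of the domain. *)
Lemma convex_linear_minorant (R : realType) (V : lmodType R)
    (M : set (V * R^o)) :
  convex_set M -> M !=set0 ->
  (forall p, M p -> exists2 q, M q & exists2 t : R, 0 < t & q.1 = - t *: p.1) ->
  (forall r, M (0, r) -> 0 <= r) ->
  exists f : {linear V -> R^o}, forall p, M p -> f p.1 <= p.2.
Proof.
move=> cM [p0 Mp0] syM posM.
have [] := @cone_linear_minorant R V
    [set t *: p | t in [set t : R | 0 <= t] & p in M]; last first.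
  move=> f fle; exists f => p Mp; apply: fle; exists 1; rewrite //=.
  by exists p; rewrite ?scale1r.
split.
- by exists 0; rewrite /= ?lexx//; exists p0; rewrite ?scale0r.
- move=> _ _ [s /= s0 [p Mp <-]] [t /= t0 [q Mq <-]].
  have [->|s1] := eqVneq s 0.
    by exists t => //; exists q => //; rewrite scale0r add0r.
  have [->|t1] := eqVneq t 0.
    by exists s => //; exists p => //; rewrite scale0r addr0.
  have [||z Mz ->] := convex_setD (a := s) (b := t) cM _ _ Mp Mq.
  - by rewrite lt_neqAle eq_sym s1.
  - by rewrite lt_neqAle eq_sym t1.
  by exists (s + t); [rewrite /= addr_ge0|exists z].
- move=> t _ t0 [s /= s0 [p Mp <-]]; exists (t * s).
    by rewrite /= mulr_ge0// ltW.
  by exists p => //; rewrite scalerA.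
- move=> _ [s /= s0 [p Mp <-]]; have [q Mq [t t0 qE]] := syM _ Mp.
  exists (s / t * q.2); exists (s / t); first by rewrite /= divr_ge0// ltW.
  exists q => //; congr pair => /=.
  by rewrite qE scalerA mulrN divfK ?gt_eqF// scaleNr.
- move=> r [s /= s0 [[v b] Mp [/eqP]]]; rewrite scaler_eq0 => + <-.
  by move=> /orP[/eqP->|/eqP v0]; rewrite ?scale0r// mulr_ge0// posM// -v0.
Qed.

(** * Locally convex spaces *)

Section tvs_facts.
Context (R : realType) (V : tvsType R).
Implicit Types (U : set V) (x z : V).

Lemma nbhs_convex U x : nbhs x U -> exists W, [/\ nbhs x W, convex_set W & W `<=` U].
Proof.
have [B cB [oB bB]] := @locally_convex R V => Ux.
have [W [BW Wx] WU] := bB x U Ux; exists W; split=> //.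
  by apply: open_nbhs_nbhs; split=> //; exact: oB.
exact/cB/mem_set.
Qed.

Lemma nbhs_shift U x : nbhs x U -> nbhs 0 [set z | U (x + z)].
Proof.
move=> Ux; have : nbhs (- x + x) (+%R (- x) @` U) by exact: nbhsB.
by rewrite addNr; apply: filterS => _ [y Uy <-]; rewrite /= addNKr.
Qed.

Lemma nbhs_unshift U x : nbhs 0 [set z | U (x + z)] -> nbhs x U.
Proof. by move=> /(nbhsT x); apply: filterS => _ [y Uy <-]. Qed.

Lemma nbhs0_scale U (r : R) : r != 0 -> nbhs 0 U -> nbhs 0 [set z | U (r *: z)].
Proof.
move=> r0 U0; have : nbhs 0 ( *:%R r^-1 @` U) by apply: nbhs0Z; rewrite ?invr_eq0.
by apply: filterS => _ [y Uy <-] /=; rewrite scalerA divff// scale1r.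
Qed.

Lemma nbhs0_absorbing U z : nbhs 0 U ->
  exists2 t : R, 0 < t & forall s, `|s| <= t -> U (s *: z).
Proof.
move=> U0; have := @scale_continuous R V (0, z) U.
rewrite /= scale0r => /(_ U0)[[A B] /= [[e /= e0 Ae] Bz] AB].
exists (e / 2); first by rewrite divr_gt0.
move=> s se; apply: (AB (s, z)); split => /=; last exact: nbhs_singleton.
apply: Ae; rewrite /ball_/= sub0r normrN (le_lt_trans se)//.
by rewrite ltr_pdivrMr// ltr_pMr// ltr1n.
Qed.

(** On the intersection of two opposite homothetic copies of U the form is small
in absolute value, and continuity at 0 is continuity everywhere. *)
Lemma bounded_linear_continuous (f : {linear V -> R^o}) U (c : R) :
  nbhs 0 U -> (forall z, U z -> f z <= c) -> continuous f.
Proof.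
move=> U0 Uc x; apply/cvgrPdist_lt => e e0.
pose c1 := Num.max c 1; have c10 : 0 < c1 by rewrite lt_max ltr01 orbT.
have k0 : 2 * c1 / e > 0 by rewrite divr_gt0// mulr_gt0.
apply: nbhs_unshift.
have k1 : - (2 * c1 / e) != 0 by rewrite oppr_eq0 gt_eqF.
have : nbhs (0 : V) ([set z | U (2 * c1 / e *: z)] `&`
                    [set z | U (- (2 * c1 / e) *: z)]).
  by apply: filterI; apply: nbhs0_scale => //; rewrite gt_eqF.
apply: filterS => z /= [/Uc h1 /Uc h2].
rewrite linearD opprD addNKr normrN.
have {h1 h2} : `|2 * c1 / e * f z| <= c1.
  move: h1 h2; rewrite !(linear_formZ f) => h1 h2.
  have cc1 : c <= c1 by rewrite le_max lexx.
  by rewrite ler_norml (le_trans h1 cc1) andbT lerNl -mulNr (le_trans h2).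
rewrite normrM (gtr0_norm k0) mulrAC ler_pdivrMr// => h.
have : c1 * (2 * `|f z|) <= c1 * e by lra.
by rewrite ler_pM2l//; lra.
Qed.

End tvs_facts.

Section convex_closure.
Context (R : realType) (V : tvsType R).

Lemma nbhs_lincomb (s t : R) (x y : V) (U : set V) : nbhs (s *: x + t *: y) U ->
  exists A B, [/\ nbhs x A, nbhs y B &
    forall a b, A a -> B b -> U (s *: a + t *: b)].
Proof.
move=> /(@add_continuous V (s *: x, t *: y))[[A B] /= [Ax By] AB].
have /(_ _ Ax)[[A1 A2] /= [A1s A2x] A12] := @scale_continuous R V (s, x).
have /(_ _ By)[[B1 B2] /= [B1t B2y] B12] := @scale_continuous R V (t, y).
exists A2, B2; split=> // a b A2a B2b; apply: (AB (s *: a, t *: b)); split=> /=.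
  by apply: (A12 (s, a)); split=> //=; exact: nbhs_singleton.
by apply: (B12 (t, b)); split=> //=; exact: nbhs_singleton.
Qed.

Lemma scaler_continuous (k : R) : continuous (fun z : V => k *: z).
Proof.
move=> z U /(@scale_continuous R V (k, z))[[A B] /= [Ak Bz] AB].
apply: filterS Bz => y By; apply: (AB (k, y)); split=> //=.
exact: nbhs_singleton.
Qed.

Lemma convex_closure (A : set V) : convex_set A -> convex_set (closure A : set V).
Proof.
move=> /convex_setP cA; apply/convex_setP => x y t t01 Ax Ay U Uxy.
have [B [D [/Ax[a [Aa Ba]] /Ay[b [Ab Db]] BD]]] := nbhs_lincomb Uxy.
by exists (t *: a + (1 - t) *: b); split; [exact: cA|exact: BD].
Qed.

End convex_closure.

(** * Continuous linear minorants and separation of points *)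

(** The bound on U only controls M along W, and the form has to be defined and
continuous on the whole space. So M is first replaced by its infimal convolution
with c1 times the gauge of U, given by the pairs (w + t u, r + t c1) with
(w, r) in M, t > 0 and u in U: its domain is absorbing, and a form below it is
bounded above on U and lies below M. Its fibre over 0 is still nonnegative:
if w + t u = 0 then u = - w / t belongs to W, and 0 is a convex
combination of w and u. *)
Lemma continuous_linear_minorant (R : realType) (V : tvsType R) (W : set V)
    (M : set (V * R^o)) (U : set V) (c : R) :
  convex_set M -> linear_subspace W -> (forall p, M p -> W p.1) ->
  (forall r, M (0, r) -> 0 <= r) ->
  nbhs 0 U -> (forall z, U z -> W z -> M (z, c)) ->
  exists2 f : {linear V -> R^o}, continuous f & forall p, M p -> f p.1 <= p.2.
Proof.
move=> cM lW MW posM U0; wlog cU : U U0 / convex_set U.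
  move=> wl Uc; have [U1 [U10 cU1 U1U]] := nbhs_convex U0.
  by apply: (wl U1) => // z /U1U; exact: Uc.
move=> Uc; pose c1 := Num.max c 1.
have c10 : 0 < c1 by rewrite lt_max ltr01 orbT.
have cc1 : c <= c1 by rewrite le_max lexx.
have M0 : M (0, c) by apply: Uc; [exact: nbhs_singleton|case: lW].
pose Q : set (V * R^o) := fun q => exists p t u,
  [/\ M p, 0 < t, U u & q = (p.1 + t *: u, p.2 + t * c1)].
have Qabs z : exists2 t : R, 0 < t & Q (t *: z, c + c1).
  have [t t0 Ut] := nbhs0_absorbing z U0; exists t => //.
  exists (0, c), 1, (t *: z); split => //; first by apply: Ut; rewrite gtr0_norm.
  by rewrite add0r scale1r mul1r.
have [] := @convex_linear_minorant R V Q.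
- apply: convex_set_oo => x y s /andP[s0 s1] [p [t [u [Mp t0 Uu ->]]]].
  move=> [q [t' [u' [Mq t'0 Uu' ->]]]].
  have s'0 : 0 < 1 - s by rewrite subr_gt0.
  have [v Uv vE] := convex_setD cU (mulr_gt0 s0 t0) (mulr_gt0 s'0 t'0) Uu Uu'.
  exists (s *: p + (1 - s) *: q), (s * t + (1 - s) * t'), v; split=> //.
  + by have /convex_setP := cM; apply => //; rewrite !ltW.
  + by rewrite addr_gt0 ?mulr_gt0.
  congr pair => /=; first by rewrite -vE !scalerDr !scalerA addrACA.
  by rewrite /GRing.scale/=; ring.
- by have [t t0 Q0] := Qabs 0; exists (t *: 0, c + c1).
- move=> [z r] _ /=; have [t t0 Qt] := Qabs (- z).
  by exists (t *: - z, c + c1) => //; exists t; rewrite //= scalerN scaleNr.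
- move=> r [[w b] [t [u [Mp t0 Uu []]]]] /= /esym/eqP; rewrite addr_eq0.
  move=> /eqP wE ->.
  have Wu : W u.
    rewrite -(scale1r u) -(mulVf (lt0r_neq0 t0)) -scalerA.
    rewrite -[t *: u]opprK -wE -scaleN1r scalerA.
    by apply: linear_subspaceZ => //; exact: MW Mp.
  have [[v a] Mv [vE rE]] := convex_setD cM ltr01 t0 Mp (Uc _ Uu Wu).
  have v0 : v = 0.
    apply: (@scalerI _ _ (1 + t)); first by rewrite lt0r_neq0// addr_gt0.
    by rewrite scaler0 -vE scale1r wE addNr.
  have : 0 <= (1 + t) * a.
    by rewrite mulr_ge0 ?addr_ge0 ?(ltW t0)//; apply: posM; rewrite -v0.
  have -> : (1 + t) * a = b + t * c.
    by rewrite -[LHS]rE -[1 *: b]/(1 * b) mul1r.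
  by move/le_trans; apply; rewrite lerD2l ler_pM2l.
move=> f fle; have {}fle p t u : M p -> 0 < t -> U u ->
    f p.1 + t * f u <= p.2 + t * c1.
  move=> Mp t0 Uu; have := fle (p.1 + t *: u, p.2 + t * c1).
  by rewrite /= linearD linearZ; apply; exists p, t, u.
exists f; last first.
  move=> p Mp; apply: (@le_add_mul_eps _ _ _ c1) => t t0.
  have := fle p t 0 Mp t0 (nbhs_singleton U0).
  by rewrite linear0 mulr0 addr0.
apply: (bounded_linear_continuous (c := c + c1) U0) => z Uz.
by have := fle (0, c) 1 z M0 ltr01 Uz; rewrite /= linear0 add0r !mul1r.
Qed.

(** Apply [continuous_linear_minorant] to the form s *: e |-> s on the line spanned by e,
which is at most 1 on any convex neighbourhood of 0 that avoids e. *)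
Lemma continuous_linear_separates (R : realType) (V : tvsType R) (e : V) :
  hausdorff_space V -> e != 0 ->
  exists2 f : {linear V -> R^o}, continuous f & f e = 1.
Proof.
move=> hV e0.
have [U U0 Ue] : exists2 U, nbhs (0 : V) U & ~ U e.
  apply: contrapT => nU; move/eqP : e0; apply; apply: hV => A B Ae B0.
  exists e; split; first exact: nbhs_singleton.
  by apply: contrapT => Be; apply: nU; exists B.
have {U U0 Ue} [U [U0 cU Ue]] : exists U, [/\ nbhs (0 : V) U, convex_set U & ~ U e].
  have [W [W0 cW WU]] := nbhs_convex U0.
  by exists W; split => // /WU.
pose M : set (V * R^o) := [set p | exists2 s : R, p.1 = s *: e & s <= p.2].
pose W : set V := range (fun s : R => s *: e).
have [] := @continuous_linear_minorant R V W M U 1.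
- apply/convex_setP => -[x a] [y b] t /andP[t0 t1] [s /= -> sa] [s' /= -> sb].
  exists (t * s + (1 - t) * s'); first by rewrite /= !scalerA -scalerDl.
  by rewrite /= lerD// ler_wpM2l// subr_ge0.
- split; first by exists 0; rewrite ?scale0r.
  by move=> l _ _ [a _ <-] [b _ <-]; exists (l * a + b); rewrite // scalerA -scalerDl.
- by move=> p [s -> _]; exists s.
- by move=> r [s /= /esym/eqP]; rewrite scaler_eq0 (negbTE e0) orbF => /eqP->.
- by [].
- move=> z Use [s _ zE]; rewrite -zE in Use *; exists s => //=.
  rewrite leNgt; apply/negP => s1.
  have s0 : 0 < s by rewrite (lt_trans _ s1).
  apply: Ue; have /convex_setP/(_ (s *: e) 0 s^-1) := cU.
  rewrite scaler0 addr0 scalerA mulVf ?gt_eqF// scale1r; apply => //.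
    by rewrite invr_ge0 (ltW s0) invf_le1// ltW.
  exact: (nbhs_singleton U0).
move=> f cf fle; exists f => //; apply/eqP; rewrite eq_le; apply/andP; split.
  by apply: (fle (e, 1)); exists 1; rewrite //= scale1r.
have : f (- e) <= -1 by apply: (fle (- e, -1)); exists (-1); rewrite //= scaleN1r.
by rewrite linearN lerN2.
Qed.

Section finite_interpolation.
Context (R : realType) (V : tvsType R).
Hypothesis hV : hausdorff_space V.
Implicit Types (f g : {linear V -> R^o}) (l : seq V).

Lemma linear_addmul f g (c : R) :
  exists2 h : {linear V -> R^o}, (forall z, h z = f z + c * g z) &
    (continuous f -> continuous g -> continuous h).
Proof.
have hlin : linear (fun z => f z + c * g z : R^o).
  by move=> t z w; rewrite !linearP /GRing.scale/=; ring.
pose L := GRing.isLinear.Build R V R^o *:%R _ hlin.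
pose h : {linear V -> R^o} := HB.pack (fun z => f z + c * g z : R^o) L.
exists h => // cf cg x; apply: (@cvgD _ R^o); first exact: cf.
by apply: (@cvgZr _ R^o); exact: cg.
Qed.

(** The first alternative expresses that e is in the span of l without naming
coefficients. By induction on l = a :: l': if some continuous form g vanishes on
l' and takes the value 1 at a, then e is replaced by e - g e *: a, and a form f
found for this vector is corrected into f - f a * g so as to vanish at a. *)
Lemma continuous_linear_biorthogonal l (e : V) :
  (forall f, {in l, forall z, f z = 0} -> f e = 0) \/
  exists f, [/\ continuous f, {in l, forall z, f z = 0} & f e = 1].
Proof.
elim: l e => [|a l IH] e.
  have [->|e0] := eqVneq e 0; first by left => f _; exact: linear0.
  by right; have [f cf fe] := continuous_linear_separates hV e0; exists f.
have [a0|[g [cg gl ga]]] := IH a.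
  have [e0|[f [cf fl fe]]] := IH e.
    by left => f fal; apply: e0 => z zl; apply: fal; rewrite inE zl orbT.
  right; exists f; split=> // z; rewrite inE => /orP[/eqP->|]; last exact: fl.
  exact: a0.
have [e0|[f [cf fl fe]]] := IH (e - g e *: a).
  left => f fal; have := e0 f; rewrite linearB linearZ/= (fal a) ?mem_head//.
  by rewrite scaler0 subr0; apply => z zl; apply: fal; rewrite inE zl orbT.
right; have [h hE ch] := linear_addmul f g (- f a); exists h; split.
- exact: ch.
- move=> z; rewrite inE => /orP[/eqP->|zl]; first by rewrite hE ga mulr1 subrr.
  by rewrite hE fl// gl// mulr0 addr0.
- move: fe; rewrite linearB linearZ hE /GRing.scale/= => <-.
  by rewrite mulNr mulrC.
Qed.

Lemma continuous_linear_interpolation f l :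
  exists2 g : {linear V -> R^o}, continuous g & {in l, forall z, g z = f z}.
Proof.
elim: l => [|a l [g cg gl]].
  exists (\0 : {linear V -> R^o}) => //; exact: cst_continuous.
have [a0|[h [ch hl ha]]] := continuous_linear_biorthogonal l a.
  exists g => // z; rewrite inE => /orP[/eqP->|]; last exact: gl.
  have [k kE _] := linear_addmul g f (-1).
  have /eqP : k a = 0 by apply: a0 => z' zl; rewrite kE gl// mulN1r subrr.
  by rewrite kE mulN1r subr_eq0 => /eqP.
have [k kE ck] := linear_addmul g h (f a - g a).
exists k; first exact: ck.
move=> z; rewrite inE kE => /orP[/eqP->|zl]; first by rewrite ha; ring.
by rewrite hl// mulr0 addr0 gl.
Qed.

End finite_interpolation.

(** The algebraic form below M is modified outside the linear hull of E only, which
leaves the inequality unchanged. *)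
Lemma finite_dimensional_minorant (R : realType) (V : tvsType R)
    (M : set (V * R^o)) (E : set V) :
  hausdorff_space V -> convex_set M -> E = [set p.1 | p in M] ->
  (forall r, M (0, r) -> 0 <= r) ->
  finite_dimensional (linear_hull E) -> ri E 0 ->
  exists2 f : {linear V -> R^o}, continuous f & forall p, M p -> f p.1 <= p.2.
Proof.
move=> hV cM ->; set E' := [set p.1 | p in M] => posM [B Bfin EB] riE.
have E0 : E' 0 by exact: (@interior_subset (subspace (affine_hull E')) _ _ riE).
have A0 : affine_hull E' 0 by exact: sub_gen_smallest.
have affE p t : M p -> affine_hull E' (t *: p.1).
  move=> Mp A /= [affA EA]; rewrite -[_ *: _]add0r -(scaler0 _ (1 - t)).
  by apply: affA; apply: EA => //; exists p.
have [U U0 UE] : exists2 U, nbhs (0 : V) U & U `&` affine_hull E' `<=` E'.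
  have /(nbhs_subspace_ex _ A0)[U U0 EU] := riE.
  by exists U => //; rewrite -EU => z [].
have [|||f fM] := convex_linear_minorant cM.
- by case: E0 => p Mp _; exists p.
- move=> p Mp; have [t t0 Ut] := nbhs0_absorbing p.1 U0.
  have [|q Mq qE] := UE (- t *: p.1).
    by split; [apply: Ut; rewrite normrN gtr0_norm|exact: affE].
  by exists q => //; exists t.
- exact: posM.
have [l lB] := (finite_seqP _).1 Bfin.
have [g cg gl] := continuous_linear_interpolation hV f l.
exists g => // p Mp; suff -> : g p.1 = f p.1 by exact: fM.
have : linear_hull B p.1.
  by rewrite -EB; apply: sub_gen_smallest; exists p.
move=> /(_ [set z | g z = f z]); apply; split.
  split; first by rewrite /= !linear0.
  by move=> t a b /= ga gb; rewrite !linearP ga gb.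
by move=> b; rewrite lB => /= bl; exact: gl.
Qed.

(** * Separation from the negative of a convex cone *)

Section cones.
Context (R : realType) (V : tvsType R) (K : set V).
Hypothesis cK : convex_cone K.

Lemma convex_cone0 : K !=set0 -> K 0.
Proof. by move=> [a Ka]; rewrite -(scale0r a); apply: cK.1. Qed.

Lemma convex_coneD a b : K a -> K b -> K (a + b).
Proof.
move=> Ka Kb; have [c Kc] := convex_setD cK.2 ltr01 ltr01 Ka Kb.
by rewrite !scale1r => ->; apply: cK.1.
Qed.

Lemma interior_convex_coneD (t : R) a b :
  0 < t -> interior K a -> K b -> interior K (t *: a + b).
Proof.
move=> t0 /nbhs_shift Ka Kb; apply: nbhs_unshift.
have tV : t^-1 != 0 by rewrite invr_eq0 gt_eqF.
apply: filterS (nbhs0_scale tV Ka) => z /= Kz.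
have : K (t *: (a + t^-1 *: z) + b).
  by apply: convex_coneD => //; apply: cK.1 => //; exact: ltW.
by rewrite scalerDr scalerA mulfV ?gt_eqF// scale1r addrAC.
Qed.

(** The form lies below the set M of the pairs (r *: k0 - p - k, r) with p in P and
k in K. Letting r tend to both infinities gives f k0 = 1, r = 0 gives
positivity, and the fibre of M over 0 is nonnegative exactly because P misses
- int K. As k0 is interior, M is bounded above near 0 in the whole space. *)
Lemma positive_separation (P : set V) (k0 : V) :
  interior K k0 -> convex_set P -> P !=set0 -> P `&` opp_set (interior K) = set0 ->
  exists f : {linear V -> R^o}, [/\ continuous f, f k0 = 1,
    forall k, K k -> 0 <= f k, forall k, interior K k -> 0 < f k
    & forall p, P p -> 0 <= f p].
Proof.
move=> Kk0 cP [p0 Pp0] PK.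
have K0 : K 0 by apply: convex_cone0; exists k0; exact: interior_subset.
pose M : set (V * R^o) :=
  [set q | exists p k, [/\ P p, K k & q.1 = q.2 *: k0 - p - k]].
(* For small s the point k0 - s *: p0 is interior to K, so that near 0 the pairs
   (z, s^-1) are in M. *)
have [s s0 Ks] := nbhs0_absorbing (- p0) (nbhs_shift (nbhs_interior Kk0)).
have {Ks} Ks : nbhs 0 [set u | K (k0 - s *: p0 - s *: u)].
  have : interior K (k0 + s *: - p0) by apply: Ks; rewrite gtr0_norm.
  move=> /nbhs_shift h; have sN : - s != 0 by rewrite oppr_eq0 gt_eqF.
  by apply: filterS (nbhs0_scale sN h) => z /=; rewrite scalerN scaleNr.
have [||||f cf fM] :=
    continuous_linear_minorant (M := M) (c := s^-1) _ (linear_subspaceT V) _ _ Ks.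
- apply/convex_setP => -[z a] [w b] t t01 [p [k [Pp Kk /= ->]]] [q [l [Pq Kl /= ->]]].
  exists (t *: p + (1 - t) *: q), (t *: k + (1 - t) *: l); split.
  + by have /convex_setP := cP; apply.
  + by have /convex_setP := cK.2; apply.
  rewrite /= -[t *: a]/(t * a) -[_ *: b]/((1 - t) * b) !scalerBr !scalerA (scalerDl k0).
  by rewrite addrACA -opprD (addrACA ((t * a) *: k0)) -opprD.
- by [].
- move=> r [p [k [Pp Kk /= rE]]]; rewrite leNgt; apply/negP => r0.
  have : (P `&` opp_set (interior K)) p; last by rewrite PK.
  split=> //; exists (- r *: k0 + k).
    by apply: interior_convex_coneD; rewrite ?oppr_gt0.
  by rewrite scaleNr opprD opprK; apply/subr0_eq; rewrite addrAC -rE.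
- move=> z Kz _; exists p0, (s^-1 *: (k0 - s *: p0 - s *: z)); split=> //.
    by apply: cK.1 => //; rewrite invr_ge0 ltW.
  rewrite /= !scalerBr !scalerA mulVf ?gt_eqF// !scale1r.
  by rewrite opprB subrKC.
have fle r p k : P p -> K k -> r * f k0 <= r + f p + f k.
  move=> Pp Kk; have : f (r *: k0 - p - k) <= r.
    by apply: (fM (r *: k0 - p - k, r)); exists p, k.
  by rewrite !linearB (linear_formZ f); lra.
have fk0 : f k0 = 1.
  apply/eqP; rewrite -subr_eq0; apply/negPn/negP => f1.
  have := fle ((f p0 + 1) / (f k0 - 1)) _ _ Pp0 K0; rewrite linear0 addr0.
  have : (f p0 + 1) / (f k0 - 1) * (f k0 - 1) = f p0 + 1 by rewrite divfK.
  by set r := _ / _; lra.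
have {}fle p k : P p -> K k -> 0 <= f p + f k.
  by move=> Pp Kk; have := fle 0 p k Pp Kk; lra.
have fP p : P p -> 0 <= f p.
  by move=> Pp; have := fle p 0 Pp K0; rewrite linear0 addr0.
have fK k : K k -> 0 <= f k.
  move=> Kk; rewrite leNgt; apply/negP => fk.
  have t0 : 0 <= (f p0 + 1) / - f k.
    by rewrite divr_ge0 ?oppr_ge0 ?(ltW fk)// addr_ge0// fP.
  have := fle p0 _ Pp0 (cK.1 _ _ t0 Kk); rewrite (linear_formZ f).
  have : (f p0 + 1) / - f k * - f k = f p0 + 1 by rewrite divfK// oppr_eq0 lt_eqF.
  by set r := _ / _; lra.
exists f; split=> // k Kk.
have [t t0 Kt] := nbhs0_absorbing (- k0) (nbhs_shift Kk).
have : 0 <= f (k + t *: - k0) by apply: fK; apply: Kt; rewrite gtr0_norm.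
by rewrite linearD (linear_formZ f) linearN fk0; lra.
Qed.

End cones.

(** * Complete translation-invariant metrics *)

(** The uniformity carried by a topological vector space need not be the
translation-invariant one, so that completeness is expressed by an explicit
metric for which Cauchy sequences converge. *)
Section metric_tvs.
Context (R : realType) (V : tvsType R) (d : V -> V -> R).
Hypothesis d0 : forall x, d x x = 0.
Hypothesis dC : forall x y, d x y = d y x.
Hypothesis dD : forall x y z, d x z <= d x y + d y z.
Hypothesis d_nbhs : forall x,
  nbhs x = filter_from [set e : R | 0 < e] (fun e => [set y | d x y < e]).
Hypothesis d_complete : forall u : nat -> V,
  (forall e : R, 0 < e -> exists N, forall m n,
     (N <= m)%N -> (N <= n)%N -> d (u m) (u n) < e) ->
  exists l : V, u @ \oo --> l.

Lemma metric_nbhs_ball x (e : R) : 0 < e -> nbhs x [set y | d x y < e].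
Proof. by move=> e0; rewrite d_nbhs; exists e. Qed.

Lemma metric_cvgP (u : nat -> V) l : u @ \oo --> l ->
  forall e : R, 0 < e -> exists N, forall n, (N <= n)%N -> d l (u n) < e.
Proof.
move=> ul e /(metric_nbhs_ball l) /ul [N _ Nu].
by exists N => n Nn; apply: Nu.
Qed.

(** Baire's theorem relative to a closed subset W. If no F n contained a ball of W,
nested closed balls with centres in W could be chosen with radii tending to 0,
so that each F n is disjoint from one of them; their centres would converge to a
point of W outside every F n. *)
Lemma metric_baire (W : set V) (F : nat -> set V) :
  closed W -> W !=set0 -> (forall n, closed (F n)) -> W `<=` \bigcup_n F n ->
  exists n w (e : R),
    [/\ 0 < e, W w & forall z, W z -> d w z < e -> F n z].
Proof.
move=> Wc [w0 Ww0] Fc WF; apply: contrapT => noball.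
pose ok (p : V * R) := W p.1 /\ 0 < p.2.
have /choice[step stepP] (np : nat * (V * R)) : exists p, ok np.2 ->
    [/\ ok p, p.2 <= np.1.+1%:R^-1 & forall y, d p.1 y <= p.2 ->
        ~ F np.1 y /\ d np.2.1 y <= np.2.2].
  case: np => n [w e] /=; have [[/= Ww e0]|nok] := pselect (ok (w, e)); last first.
    by exists (w, e) => ?; exfalso; exact: nok.
  have [z [Wz wz nFz]] : exists z, [/\ W z, d w z < e & ~ F n z].
    apply: contrapT => nz; apply: noball; exists n, w, e; split=> // z Wz wz.
    by apply: contrapT => nFz; apply: nz; exists z.
  have : nbhs z (~` F n).
    by apply: open_nbhs_nbhs; split=> //; apply: closed_openC; exact: Fc.
  rewrite d_nbhs => -[e1 /= e10 e1F].
  pose e2 := Num.min (e1 / 2) (Num.min (e - d w z) n.+1%:R^-1).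
  exists (z, e2) => _; split=> /=.
  - split=> //=; rewrite !lt_min divr_gt0//= subr_gt0 wz/= invr_gt0.
    by rewrite ltr0n.
  - by rewrite !ge_min lexx !orbT.
  - move=> y; rewrite !le_min => /and3P[y1 y2 _]; split.
      by apply: e1F => /=; rewrite (le_lt_trans y1)// gtr_pMr// invf_lt1// ltr1n.
    by rewrite (le_trans (dD w z y))//; lra.
pose s := fix s n := if n is m.+1 then step (m, s m) else (w0, 1).
have sok n : ok (s n).
  elim: n => [|n IH] /=; first by split.
  by have [] := stepP (n, s n) IH.
have sS n y : d (s n.+1).1 y <= (s n.+1).2 -> d (s n).1 y <= (s n).2.
  by move=> ys; have [_ _ /(_ _ ys)[]] := stepP (n, s n) (sok n).
have nested n k y : d (s (k + n)%N).1 y <= (s (k + n)%N).2 -> d (s n).1 y <= (s n).2.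
  by elim: k => // k IH /sS.
have sin n m : (n <= m)%N -> d (s n).1 (s m).1 <= (s n).2.
  move=> nm; apply: (nested n (m - n)%N); rewrite subnK// d0.
  by have [_ /ltW] := sok m.
have small (e : R) : 0 < e -> exists n, (s n.+1).2 < e.
  move=> e0; have [N _ /(_ N (leqnn N)) Ne] := near_infty_natSinv_lt (PosNum e0).
  exists N; apply: le_lt_trans Ne.
  by have [_ ?] := stepP (N, s N) (sok N).
have [|l sl] := @d_complete (fun n => (s n).1).
  move=> e e0; have e20 : 0 < e / 2 by rewrite divr_gt0.
  have [N Ne] := small _ e20.
  exists N.+1 => m n Nm Nn; have := sin _ _ Nm; have := sin _ _ Nn.
  have := dD (s m).1 (s N.+1).1 (s n).1; rewrite (dC (s m).1 (s N.+1).1); lra.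
have lin n : d (s n).1 l <= (s n).2.
  apply/ler_addgt0Pr => e e0; have [N Nl] := metric_cvgP sl e0.
  have := sin n (maxn n N) (leq_maxl _ _); have := Nl (maxn n N) (leq_maxr _ _).
  have := dD (s n).1 (s (maxn n N)).1 l; rewrite (dC (s (maxn n N)).1 l); lra.
have Wl : W l.
  apply: (@closed_cvg _ _ \oo _ (fun n => (s n).1) W) => //.
  by apply: nearW => n; have [] := sok n.
have [n _ Fl] := WF l Wl.
by have [_ _ /(_ _ (lin n.+1))[]] := stepP (n, s n) (sok n).
Qed.

Lemma metric_geometric_cvg (u : nat -> V) :
  (forall n, d (u n) (u n.+1) <= 2^-1 ^+ n) -> exists l : V, u @ \oo --> l.
Proof.
move=> ud; apply: d_complete => e e0.
have dist k N : d (u N) (u (N + k)%N) <= 2 * 2^-1 ^+ N.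
  elim: k N => [|k IH] N; first by rewrite addn0 d0 mulr_ge0// exprn_ge0// invr_ge0.
  have := dD (u N) (u N.+1) (u (N + k.+1)%N); have := IH N.+1.
  rewrite addSnnS exprS; have := ud N; lra.
have : (fun n : nat => (2^-1 : R) ^+ n) @ \oo --> (0 : R).
  by apply: cvg_expr; rewrite ger0_norm ?invr_ge0// invf_lt1// ltr1n.
move=> /cvgrPdist_lt /(_ (e / 4)); rewrite divr_gt0// => /(_ isT)[N _ /(_ N (leqnn N))].
rewrite /= sub0r normrN ger0_norm ?exprn_ge0 ?invr_ge0// => Ne.
exists N => m n Nm Nn; have := dist (m - N)%N N; have := dist (n - N)%N N.
rewrite !subnKC//; have := dD (u m) (u N) (u n); rewrite (dC (u m) (u N)); lra.
Qed.

End metric_tvs.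

(** * Openness of closed convex relations *)

Section robinson_ursescu.
Context (R : realType) (X Z : tvsType R).
Hypotheses (fX : frechet_space X) (fZ : frechet_space Z).
Variables (H : set (X * Z)) (W : set Z) (x0 : X).
Hypotheses (cH : convex_set H) (Hclosed : closed H).
Hypotheses (Wlin : linear_subspace W) (Wclosed : closed W).
Hypotheses (HW : forall p, H p -> W p.2) (H0 : H (x0, 0)).
Hypothesis Habs : forall w, W w -> exists2 t : R, 0 < t & exists x, H (x, t *: w).

Let fiber (N : set X) : set Z := [set z | exists2 x, N x & H (x0 + x, z)].

Let fiber_convex N : convex_set N -> convex_set (fiber N).
Proof.
move=> /convex_setP cN; apply/convex_setP => z w t t01 [x Nx Hx] [y Ny Hy].
exists (t *: x + (1 - t) *: y); first exact: cN.
have /convex_setP/(_ _ _ t t01 Hx Hy) := cH.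
congr H; congr pair => /=.
by rewrite !scalerDr addrACA -scalerDl subrKC scale1r.
Qed.

Let fiber_absorbing N w : nbhs 0 N -> W w ->
  exists2 t : R, 0 < t & forall s, 0 <= s <= t -> fiber N (s *: w).
Proof.
move=> N0 Ww; have [t t0 [x Hx]] := Habs Ww.
have [e e0 Ne] := nbhs0_absorbing (x - x0) N0.
exists (t * Num.min e 1); first by rewrite mulr_gt0// lt_min e0 ltr01.
move=> s /andP[s0 st]; have st' : s / t <= Num.min e 1 by rewrite ler_pdivrMr// mulrC.
have stp : 0 <= s / t by rewrite divr_ge0// ltW.
exists ((s / t) *: (x - x0)).
  by apply: Ne; rewrite ger0_norm// (le_trans st')// ge_min lexx.
have s01 : 0 <= s / t <= 1 by rewrite stp (le_trans st')// ge_min lexx orbT.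
have /convex_setP/(_ _ _ _ s01 Hx H0) := cH; congr H; congr pair => /=.
  by rewrite scalerBr scalerBl scale1r addrCA.
by rewrite scaler0 addr0 scalerA divfK// gt_eqF.
Qed.

(** The homothetic copies of the closed set in the conclusion cover W, as the
fiber is absorbing, so that Baire's theorem gives it an interior point
relative to W; convexity then moves this point to 0. *)
Lemma fiber_closure_nbhs N : nbhs 0 N -> convex_set N ->
  exists2 U, nbhs (0 : Z) U & U `&` W `<=` closure (fiber N).
Proof.
move=> N0 cN.
have [d [[dge deq dC dD] dt dn dc]] := fZ.
have dxx x : d x x = 0 by apply/deq.
pose F n := [set z : Z | closure (fiber N) (n.+1%:R^-1 *: z)].
have [|n||n [w [e [e0 Ww wF]]]] := metric_baire dxx dC dD dn dc (F := F) Wclosed.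
- by exists 0; case: Wlin.
- apply: closed_comp; last exact: closed_closure.
  by move=> z _; exact: scaler_continuous.
- move=> w Ww; have [t t0 Nt] := fiber_absorbing N0 Ww.
  have [n _ /(_ n (leqnn n)) nt] := near_infty_natSinv_lt (PosNum t0).
  exists n => //; apply: subset_closure; apply: Nt.
  by rewrite invr_ge0 ler0n ltW.
pose k : R := n.+1%:R.
have k0 : 0 < k by rewrite ltr0n.
have [t t0 tN] := fiber_absorbing N0 (linear_subspaceZ (- k^-1) Wlin Ww).
have t1 : 0 < 1 + t by rewrite addr_gt0.
(* The interior point (w + k u) / k of the closure of the fiber is balanced
   against - t (w / k), a point of the fiber in the opposite direction. *)
have cP : 0 < t / (1 + t) by rewrite divr_gt0.
exists [set z | [set y | d w y < e] (w + k *: ((1 + t) / t *: z))].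
  apply: (nbhs0_scale (V := Z) _ (U := [set z | d w (w + k *: z) < e])).
    by rewrite gt_eqF// divr_gt0.
  apply: (nbhs0_scale (V := Z) _ (U := [set z | d w (w + z) < e])).
    by rewrite gt_eqF.
  by apply: (nbhs_shift (U := [set y | d w y < e])); rewrite dn; exists e.
move=> z [/= zU Wz].
set v := w + _ in zU.
have Wv : W v.
  by rewrite /v addrC; apply: Wlin.2 => //; exact: linear_subspaceZ.
have Fv := wF _ Wv zU.
have Ft : closure (fiber N) (t *: (- k^-1 *: w)).
  by apply: subset_closure; apply: tN; rewrite (ltW t0) lexx.
have /convex_setP/(_ _ _ (t / (1 + t)) _ Fv Ft) := convex_closure (fiber_convex cN).
have -> : (t / (1 + t)) *: (n.+1%:R^-1 *: v) +
  (1 - t / (1 + t)) *: (t *: (- k^-1 *: w)) = z.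
  rewrite /v -/k !scalerDr !scalerA addrAC -scalerDl.
  rewrite [X in X *: w](_ : _ = 0); last by field; rewrite !gt_eqF.
  rewrite scale0r add0r [X in X *: z](_ : _ = 1) ?scale1r//.
  by field; rewrite !gt_eqF.
by apply; rewrite (ltW cP) ler_pdivrMr// mul1r lerDr ler01.
Qed.


(** Let N k and V k be neighbourhoods of 0 of size 2 ^ - k such that V k, within
W, is contained in the closure of the fiber of N k. A point v k of V k can be
approximated by some z k, in the fiber of N k at x k, so well that the doubled
error v k.+1 = 2 (v k - z k) is in V k.+1. Then v 0 / 2 is the sum of the
z k / 2 ^ k.+1, and the partial sums s of the series with terms
x k / 2 ^ k.+1 converge. By convexity (x0 + s k, t k) is in H,
where t k is the corresponding partial sum for z; the limit is in H as H is
closed. *)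
Lemma robinson_ursescu :
  exists2 U, nbhs (0 : Z) U & forall z, U z -> W z -> exists x, H (x, z).
Proof.
have [dX [[_ eqX dXC dXD] dXt dXn dXc]] := fX.
have [dZ [[_ eqZ dZC dZD] dZt dZn dZc]] := fZ.
have dXxx x : dX x x = 0 by apply/eqX.
pose h : R := 2^-1.
have h0 : 0 < h by rewrite invr_gt0.
have h1 : h < 1 by rewrite invf_lt1// ltr1n.
have hk0 k : 0 < h ^+ k by rewrite exprn_gt0.
have hk1 k : 0 <= h ^+ k <= 1 by rewrite ltW//= exprn_ile1// ltW.
have /choice[N Np] (k : nat) : exists N, [/\ nbhs (0 : X) N, convex_set N &
    N `<=` [set x | dX 0 x < h ^+ k]].
  by apply: nbhs_convex; rewrite dXn; exists (h ^+ k) => //=.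
have /choice[V Vp] (k : nat) : exists V, [/\ nbhs (0 : Z) V, convex_set V &
    V `<=` [set z | dZ 0 z < h ^+ k] `&` [set z | W z -> closure (fiber (N k)) z]].
  apply: nbhs_convex; apply: filterI.
    by rewrite dZn; exists (h ^+ k) => //=.
  have [N0 cN _] := Np k; have [U U0 UN] := fiber_closure_nbhs N0 cN.
  by apply: filterS U0 => z Uz Wz; exact: UN.
have /choice[step stepP] (kv : nat * Z) : exists xz : X * Z,
    V kv.1 kv.2 -> W kv.2 ->
    [/\ N kv.1 xz.1, H (x0 + xz.1, xz.2) & V kv.1.+1 (2 *: (kv.2 - xz.2))].
  case: kv => k v /=; have [Vv|] := pselect (V k v); last by exists (0, 0).
  have [Wv|] := pselect (W v); last by exists (0, 0).
  have [_ _ /(_ _ Vv)[_ /(_ Wv) clv]] := Vp k.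
  have [V0 _ _] := Vp k.+1.
  have : nbhs v [set z | V k.+1 (2 *: (v - z))].
    apply: nbhs_unshift.
    have : nbhs 0 [set z : Z | V k.+1 ((- 2) *: z)].
      by apply: nbhs0_scale; rewrite ?oppr_eq0// pnatr_eq0.
    apply: filterS => z /=; have -> : v - (v + z) = - z.
      by rewrite opprD addrA subrr add0r.
    by rewrite scalerN scaleNr.
  move=> /clv[z [[x Nx Hx] Vz]]; by exists (x, z).
exists [set z | V 0%N (2 *: z)].
  by apply: nbhs0_scale; [rewrite pnatr_eq0|case: (Vp 0%N)].
move=> z /= Vz Wz.
pose v := fix v k := if k is j.+1 then 2 *: (v j - (step (j, v j)).2) else 2 *: z.
have vok k : V k (v k) /\ W (v k).
  elim: k => [|k [IHV IHW]] /=; first by split=> //; exact: linear_subspaceZ.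
  have [_ HH VV] := stepP (k, v k) IHV IHW; split=> //.
  apply: linear_subspaceZ => //; rewrite addrC -scaleN1r.
  by apply: Wlin.2 => //; exact: (HW HH).
pose x k := (step (k, v k)).1.
have xN k : N k (x k).
  by have [VV WW] := vok k; have [] := stepP (k, v k) VV WW.
have xH k : H (x0 + x k, (step (k, v k)).2).
  by have [VV WW] := vok k; have [] := stepP (k, v k) VV WW.
pose s := fix s k := if k is j.+1 then s j + h ^+ j.+1 *: x j else 0.
pose t k := z - h ^+ k.+1 *: v k.
have tS k : t k.+1 = t k + h ^+ k.+1 *: (step (k, v k)).2.
  rewrite /t /= scalerA [h ^+ k.+2]exprSr.
  have -> : h ^+ k.+1 * h * 2 = h ^+ k.+1 by rewrite mulfVK ?pnatr_eq0.
  by rewrite scalerBr opprB addrCA addrC.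
(* The remaining mass 2 ^ - k of the convex combination is carried by an arbitrary
   element of H, which makes the induction go through; it is taken to be (x0, 0)
   in the end. *)
have stH k : forall u w, H (x0 + u, w) ->
    H (x0 + s k + h ^+ k *: u, t k + h ^+ k *: w).
  elim: k => [|k IH] u w Huw.
    rewrite /= expr0 !scale1r addr0 /t expr1 /= scalerA mulVf ?pnatr_eq0//.
    by rewrite scale1r subrr add0r.
  have h01 : 0 <= h <= 1 by rewrite !ltW.
  have /convex_setP/(_ _ _ h h01 (xH k) Huw) := cH.
  have -> : 1 - h = h by rewrite /h; field.
  set p := _ + _; have pE : p = (x0 + h *: (x k + u),
      h *: ((step (k, v k)).2 + w)).
    congr pair => /=; last by rewrite scalerDr.
    rewrite !scalerDr addrACA -scalerDl.
    by rewrite [h + h](_ : _ = 1) ?scale1r//; rewrite /h; field.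
  rewrite pE => /IH; congr H; congr pair.
    by rewrite /= scalerA -exprSr scalerDr !addrA.
  by rewrite tS scalerA -exprSr scalerDr !addrA.
have [l sl] : exists l : X, s @ \oo --> l.
  apply: (metric_geometric_cvg dXxx dXC dXD dXc) => k.
  have [N0 cN NB] := Np k.
  have : N k (h ^+ k.+1 *: x k).
    have /convex_setP/(_ (x k) 0 _ (hk1 k.+1) (xN k) (nbhs_singleton N0)) := cN.
    by rewrite scaler0 addr0.
  move=> /NB /= /ltW; have := dXt 0 (h ^+ k.+1 *: x k) (s k).
  by rewrite add0r addrC => ->.
have tz : t @ \oo --> z.
  move=> U; rewrite dZn => -[e /= e0 eU].
  have : (fun n : nat => h ^+ n) @ \oo --> (0 : R).
    by apply: cvg_expr; rewrite ger0_norm ?ltW.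
  move=> /cvgrPdist_lt /(_ e e0); apply: filterS => k.
  rewrite sub0r normrN ger0_norm ?ltW// => ke.
  apply: eU => /=; rewrite (lt_trans _ ke)//.
  have [V0 cV VB] := Vp k; have [Vv _] := vok k.
  have : V k (h ^+ k.+1 *: v k).
    have /convex_setP/(_ (v k) 0 _ (hk1 k.+1) Vv (nbhs_singleton V0)) := cV.
    by rewrite scaler0 addr0.
  move=> /VB[/= + _]; have := dZt 0 (h ^+ k.+1 *: v k) (t k).
  by rewrite add0r /t subrKC dZC => ->.
exists (x0 + l).
apply: (@closed_cvg _ _ \oo _ (fun k => (x0 + s k, t k) : X * Z) H) => //.
  apply: nearW => k; have := stH k 0 0.
  by rewrite !scaler0 !addr0; exact.
apply: cvg_pair => //=.
move=> U /(@add_continuous X (x0, l))[[A B] /= [Ax Bl] AB].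
have : \forall k \near \oo, B (s k) by exact: sl.
apply: filterS => k Bk; apply: (AB (x0, s k)); split=> //=.
exact: nbhs_singleton.
Qed.

End robinson_ursescu.

(** * Perturbed convex programs *)

Section perturbation.
Context (R : realType) (X Z : tvsType R) (Phi : set (X * (Z * R^o))).
Hypothesis cPhi : convex_set Phi.

(** If Phi is upward closed in r, this is, up to infima that are not attained, the
epigraph of the value function z |-> inf r over the (x, (z, r)) in Phi. *)
Definition marginal : set (Z * R^o) := [set q | exists x, Phi (x, q)].

Lemma marginal_convex : convex_set marginal.
Proof.
apply/convex_setP => p q t t01 [x Hx] [y Hy]; exists (t *: x + (1 - t) *: y).
by have /convex_setP/(_ _ _ _ t01 Hx Hy) := cPhi.
Qed.

(** Apply the openness theorem to the level c = r0 + 1 of the program.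
Restricting to this level does not shrink the cone generated by the domain: moving
from (x0, 0) towards any (x, z) by a small enough step keeps the value below
r0 + 1. *)
Lemma frechet_minorant (x0 : X) (r0 : R) :
  frechet_space X -> frechet_space Z ->
  (forall c : R, closed [set p : X * Z | Phi (p.1, (p.2, c))]) ->
  (forall x z (r s : R), r <= s -> Phi (x, (z, r)) -> Phi (x, (z, s))) ->
  Phi (x0, (0, r0)) -> (forall r, marginal (0, r) -> 0 <= r) ->
  sqri [set q.1 | q in marginal] 0 ->
  exists2 f : {linear Z -> R^o}, continuous f &
    forall q, marginal q -> f q.1 <= q.2.
Proof.
move=> fX fZ Phic Phiup Phi0 pos [_ Wclosed Wlin].
set E := [set q.1 | q in marginal] in Wclosed Wlin.
have EW z : E z -> cone_at E 0 z.
  by move=> Ez; exists 1; rewrite //=; exists z; rewrite // subr0 scale1r.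
pose c := r0 + 1; pose H := [set p : X * Z | Phi (p.1, (p.2, c))].
have r0c : r0 <= c by rewrite lerDl.
have H0 : H (x0, 0) by apply: Phiup Phi0.
have cH : convex_set H.
  apply/convex_setP => -[x z] [x' z'] t t01 Hx Hy.
  have /convex_setP/(_ _ _ _ t01 Hx Hy) := cPhi.
  congr Phi; congr (_, (_, _)) => /=.
  by rewrite /GRing.scale/=; ring.
have HW p : H p -> cone_at E 0 p.2.
  by move=> Hp; apply: EW; exists (p.2, c) => //; exists p.1.
have Habs w : cone_at E 0 w -> exists2 t : R, 0 < t & exists x, H (x, t *: w).
  move=> [l /= l0 [v [[z r] [x Hx] /= <-] <-]]; rewrite subr0.
  have [->|ln0] := eqVneq l 0.
    by exists 1 => //; exists x0; rewrite scale0r scaler0.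
  pose m := 1 + `|r - r0|; have m0 : 0 < m by rewrite ltr_wpDr.
  have lp : 0 < l by rewrite lt_neqAle eq_sym ln0.
  have m01 : 0 <= m^-1 <= 1 by rewrite invr_ge0 (ltW m0)/= invf_le1// lerDl.
  exists (m^-1 / l); first by rewrite divr_gt0// invr_gt0.
  have /convex_setP/(_ _ _ _ m01 Hx Phi0) := cPhi => Hm.
  exists (m^-1 *: x + (1 - m^-1) *: x0).
  apply: (Phiup _ _ (m^-1 * r + (1 - m^-1) * r0)).
    rewrite /c -lerBlDl (_ : _ - _ = (r - r0) / m); last by ring.
    by rewrite ler_pdivrMr// mul1r /m (le_trans (ler_norm _))// lerDr.
  move: Hm; congr Phi; congr (_, (_, _)) => /=.
  by rewrite scaler0 addr0 scalerA divfK.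
have [U U0 UH] := robinson_ursescu fX fZ cH (Phic c) Wlin Wclosed HW H0 Habs.
apply: (continuous_linear_minorant marginal_convex Wlin _ pos U0) => [p Mp|].
  by apply: EW; exists p.
exact: UH.
Qed.

End perturbation.

Section vector_mappings.
Context (R : realType) (X Y : tvsType R).
Implicit Types (K : set Y) (F : X -> \bar Y).

Lemma epiP K F x y :
  epi K F (x, y) <-> exists v k, [/\ F x = v%:E, K k & y = v + k].
Proof.
split=> [[k Kk]|[v [k [Fx Kk ->]]]]; last by exists k => //=; rewrite Fx.
by rewrite /=; case: (F x) => [v [yE]|//|//]; exists v, k.
Qed.

Lemma proper_domP F x : is_proper F -> dom F x -> exists v, F x = v%:E.
Proof.
move=> [_ Fy] Fx; case E : (F x) => [v||]; [by exists v|by []|].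
by exfalso; apply: Fy; exists x.
Qed.

(** Off the sublevel set, the scalarized value of F exceeds a real b larger than
c + f (L x) - f y, which lower semicontinuity preserves nearby, while f (L x)
varies little. *)
Lemma sublevel_closed F (L : {linear X -> Y}) (f : {linear Y -> R^o}) y (c : R) :
  is_proper F -> continuous L -> continuous f ->
  lower_semicontinuous (fun x => er_map f (F x) : \bar R) ->
  closed [set x | exists2 v, F x = v%:E & f (v - L x + y) <= c].
Proof.
move=> Fp cL cf lf; rewrite -openC openE => x /= nx.
pose a := c + f (L x) - f y.
have [b ab bF] : exists2 b : R, a < b & (b%:E < er_map f (F x))%E.
  case Fx : (F x) => [v||]; last by exfalso; apply: Fp.2; exists x.
    have av : a < f v.
      rewrite ltNge; apply/negP => va; apply: nx; exists v => //.
      by rewrite linearD linearB; move: va; rewrite /a; lra.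
    by exists ((a + f v) / 2); rewrite /= ?lte_fin; lra.
  by exists (a + 1); rewrite ?ltrDl//= ltry.
have [V Vx bV] := lf x b bF.
have : nbhs x [set x' | f (L x') < f (L x) + (b - a)].
  have fLx : (fun x' => f (L x')) @ x --> f (L x).
    by apply: continuous_comp; [exact: cL|exact: cf].
  by apply: (cvgr_lt _ fLx); rewrite ltrDl subr_gt0.
move=> Lx; apply: filterS (filterI Vx Lx) => x' [/bV bx' Lx'] [v Fx' fv].
move: bx'; rewrite Fx' /= lte_fin.
move: fv; rewrite linearD linearB.
move: Lx'; rewrite /= /a; lra.
Qed.

End vector_mappings.

(** * Scalarization of the vector program *)

Section scalarized_program.
Context (R : realType) (X Y Z : tvsType R) (K : set Y) (S : set Z) (C : set X).
Context (F : X -> \bar Y) (G : X -> \bar Z) (L : {linear X -> Y}) (y : Y).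
Variable f : {linear Y -> R^o}.
Hypothesis cC : convex_set C.
Hypothesis Fproper : is_proper F.
Hypotheses (cF : K_convex K F) (cG : K_convex S G).
Hypotheses (K0 : K 0) (fK : forall k, K k -> 0 <= f k).

(** The perturbed problem of minimizing f (F x - L x + y) over x in C subject to
z in G x + S; the perturbation z = 0 gives back the constraint G x in - S. *)
Definition program : set (X * (Z * R^o)) :=
  [set p | [/\ C p.1, epi S G (p.1, p.2.1) &
     exists2 v, F p.1 = v%:E & f (v - L p.1 + y) <= p.2.2]].

Lemma K_convex_fin x x' v v' (t : R) : 0 <= t <= 1 ->
  F x = v%:E -> F x' = v'%:E ->
  exists w k, [/\ F (t *: x + (1 - t) *: x') = w%:E, K k &
    t *: v + (1 - t) *: v' = w + k].
Proof.
move=> t01 Fx Fx'; apply/epiP.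
have Ex : epi K F (x, v) by apply/epiP; exists v, 0; rewrite addr0.
have Ex' : epi K F (x', v') by apply/epiP; exists v', 0; rewrite addr0.
exact: (convex_setP (epi K F)).1 cF _ _ _ t01 Ex Ex'.
Qed.

Lemma lincomb_shift (t : R) x x' v v' :
  t *: (v - L x + y) + (1 - t) *: (v' - L x' + y) =
  (t *: v + (1 - t) *: v') - L (t *: x + (1 - t) *: x') + y.
Proof.
rewrite 4!scalerDr addrACA -scalerDl subrKC scale1r addrACA; congr (_ + _ + _).
by rewrite linearD !linearZ opprD !scalerN.
Qed.

Lemma program_convex : convex_set program.
Proof.
apply/convex_setP => -[x [z r]] [x' [z' r']] t t01.
move=> [/= Cx Gx [v Fx vr]] [/= Cx' Gx' [v' Fx' vr']].
have [w [k [Fw Kk wk]]] := K_convex_fin t01 Fx Fx'.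
split=> /=.
- exact: (convex_setP C).1 cC _ _ _ t01 Cx Cx'.
- exact: (convex_setP (epi S G)).1 cG _ _ _ t01 Gx Gx'.
exists w => //; have /andP[t0 t1] := t01.
apply: (@le_trans _ _ (t * f (v - L x + y) + (1 - t) * f (v' - L x' + y))).
  rewrite -!(linear_formZ f) -linearD lincomb_shift wk (addrAC w k) (addrAC _ k).
  by rewrite [leRHS]linearD lerDl fK.
by rewrite lerD// ler_wpM2l// subr_ge0.
Qed.

Lemma program_closed (c : R) : closed C -> K_epi_closed S G ->
  continuous L -> continuous f ->
  lower_semicontinuous (fun x => er_map f (F x) : \bar R) ->
  closed [set p : X * Z | program (p.1, (p.2, c))].
Proof.
move=> Cc Gc cL cf lf.
have -> : [set p : X * Z | program (p.1, (p.2, c))] = (fst @^-1` C) `&` epi S G `&`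
    (fst @^-1` [set x | exists2 v, F x = v%:E & f (v - L x + y) <= c]).
  by apply/seteqP; split=> [[x z] []//|[x z] [[]]].
apply: closedI; first apply: closedI => //; apply: closed_comp => //.
- by move=> p _; exact: cvg_fst.
- by move=> p _; exact: cvg_fst.
- exact: sublevel_closed.
Qed.

End scalarized_program.

(** * Lagrange multipliers for the vector program *)

Theorem theorem4p6 (R : realType) (X Y Z : tvsType R)
  (hX : hausdorff_space X) (hY : hausdorff_space Y) (hZ : hausdorff_space Z)
  (K : set Y) (Kclosed : closed K) (Kpointed : pointed K)
  (Kcone : convex_cone K) (Kint : interior K !=set0)
  (S : set Z) (Snonempty : S !=set0) (Sclosed : closed S)
  (Scone : convex_cone S)
  (C : set X) (Cnonempty : C !=set0) (Cconvex : convex_set C)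
  (F : X -> \bar Y) (Fproper : is_proper F) (Fconvex : K_convex K F)
  (G : X -> \bar Z) (Gproper : is_proper G) (Gconvex : K_convex S G)
  (A : set X) (A_def : A = C `&` G @^-1` (EFin @` opp_set S))
  (E : set Z)
  (E_def : E = add_set (EFin @^-1` (G @` (C `&` dom F `&` dom G))) S)
  (Afeasible : A `&` dom F !=set0)
  (c123 :
    [\/ (* c1 *)
        exists2 xbar, (C `&` dom F) xbar &
          (EFin @` opp_set (interior S)) (G xbar),
        (* c2 *)
        [/\ frechet_space X /\ frechet_space Z,
            closed C,
            forall ystar : {linear Y -> R^o}, continuous ystar ->
              lower_semicontinuous (fun x => er_map ystar (F x) : \bar R),
            K_epi_closed S G
          & sqri E 0]
      | (* c3 *)
        finite_dimensional (linear_hull E) /\ ri E 0])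
  (L : {linear X -> Y}) (Lcont : continuous L) (y : Y) :
  (forall x, C x -> (EFin @` opp_set S) (G x) ->
     ~ (EFin @` opp_set (interior K)) (F x + (- L x)%:E + y%:E)%E)
  <->
  (exists2 T : {linear Z -> Y}, weakly_positive S K T &
     forall x, C x ->
       ~ (EFin @` add_set (T @` opp_set S) (opp_set (interior K)))
           (F x + er_map T (G x) + (- L x)%:E + y%:E)%E).
Proof.
split=> [b1|[T _ b3] x Cx [z Sz Gx] [k Kk Fxk]]; last first.
  apply: (b3 x Cx); exists (T z + k).
    by exists (T z); [exists z|exists k].
  move: Fxk; rewrite -Gx; case: (F x) => [v||]//= [->].
  by congr EFin; rewrite !addrA [T z + v]addrC.
have [k0 Kk0] := Kint.
have K0 : K 0 by apply: convex_cone0 => //; exists k0; exact: interior_subset.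
have S0 : S 0 by exact: convex_cone0.
have [x0 [Ax0 Fx0]] := Afeasible; move: Ax0; rewrite A_def => -[Cx0 [_ [s0 Ss0 <-] Gx0]].
have [v0 {}Fx0] := proper_domP Fproper Fx0.
pose P : set Y := [set p | exists x v k, [/\ C x, epi S G (x, 0), F x = v%:E, K k &
   p = v - L x + y + k]].
have PK : P `&` opp_set (interior K) = set0.
  apply/eqP/negPn/negP => /set0P[_ [[x [v [k [Cx + Fx Kk ->]]]] [k' Kk' kE]]].
  move=> /epiP[w [s [Gx Ss ws]]].
  apply: (b1 x Cx).
    exists w; last by rewrite Gx.
    by exists s => //; apply/eqP; rewrite eq_sym -addr_eq0 ws.
  exists (- (1 *: k' + k)).
    by exists (1 *: k' + k) => //; exact: interior_convex_coneD.
  rewrite Fx; congr EFin; rewrite scale1r opprD kE.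
  by rewrite addrK.
have cP : convex_set P.
  apply/convex_setP => p q t t01 [x [v [k [Cx Gx Fx Kk ->]]]].
  move=> [x' [v' [k' [Cx' Gx' Fx' Kk' ->]]]].
  have [w [l [Fw Kl wl]]] := K_convex_fin Fconvex K0 t01 Fx Fx'.
  exists (t *: x + (1 - t) *: x'), w, (l + (t *: k + (1 - t) *: k')); split=> //.
  - exact: (convex_setP C).1 Cconvex _ _ _ t01 Cx Cx'.
  - have := (convex_setP (epi S G)).1 Gconvex _ _ _ t01 Gx Gx'.
    by congr epi; congr pair => /=; rewrite !scaler0 addr0.
  - apply: convex_coneD => //.
    exact: (convex_setP K).1 Kcone.2 _ _ _ t01 Kk Kk'.
  - rewrite scalerDr [X in _ + X]scalerDr addrACA lincomb_shift wl.
    by rewrite (addrAC w l) (addrAC _ l) [RHS]addrA.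
have G0 : epi S G (x0, 0) by apply/epiP; exists (- s0), s0; rewrite addNr.
have [|f [cf fk0 fK fKint fP]] := positive_separation Kcone Kk0 cP _ PK.
  by exists (v0 - L x0 + y + 0), x0, v0, 0.
pose Phi := program S C F G L y f.
have cPhi : convex_set Phi by exact: (program_convex Cconvex Fconvex Gconvex K0 fK).
have pos r : marginal Phi (0, r) -> 0 <= r.
  move=> [x [/= Cx Gx [v Fx]]]; apply: le_trans; apply: fP.
  by exists x, v, 0; rewrite addr0.
have EM : E = [set q.1 | q in marginal Phi].
  rewrite E_def; apply/seteqP; split=> [_ [w [x [[Cx Fx] _] Gx] [s Ss <-]]|].
    have [v {}Fx] := proper_domP Fproper Fx.
    exists (w + s, f (v - L x + y)) => //; exists x; split=> //=; last by exists v.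
    by apply/epiP; exists w, s.
  move=> _ [[z r] [x [/= Cx /epiP[w [s [Gx Ss ->]]] [v Fx _]]] <-].
  exists w; last by exists s.
  by exists x => //; split; [split=> //|]; rewrite /dom /= ?Fx ?Gx.
have [g cg gM] : exists2 g : {linear Z -> R^o}, continuous g &
    forall q, marginal Phi q -> g q.1 <= q.2.
  case: c123 => [[x [Cx Fx] [_ [s Ss <-] Gx]]|[[fX fZ] Cc lsc Gc sqE]|[fd riE]].
  - have [v {}Fx] := proper_domP Fproper Fx.
    apply: (continuous_linear_minorant (W := setT) (c := f (v - L x + y))
      (marginal_convex cPhi) (linear_subspaceT _) _ pos (nbhs_shift Ss)) => //.
    move=> z Sz _; exists x; split=> //=; last by exists v.
    by apply/epiP; exists (- s), (s + z); rewrite addKr.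
  - apply: (frechet_minorant (x0 := x0) (r0 := f (v0 - L x0 + y)) cPhi fX fZ) => //.
    + by move=> c; apply: program_closed => //; exact: lsc.
    + move=> x z r r' rr' [Cx Gx [v Fx vr]]; split=> //.
      by exists v => //; exact: le_trans rr'.
    + by split=> //; exists v0.
    + by rewrite -EM.
  - by apply: (finite_dimensional_minorant hZ (marginal_convex cPhi) EM).
have gS s : S s -> g s <= 0.
  (* The value of g at t^-1 *: s is bounded by the objective value at x0. *)
  move=> Ss; apply: (@le_add_mul_eps _ _ _ (f (v0 - L x0 + y))) => t t0.
  rewrite add0r -ler_pdivrMl// -(linear_formZ g); apply: (gM (_, _)).
  exists x0; split=> //=; last by exists v0.
  apply/epiP; exists (- s0), (s0 + t^-1 *: s); rewrite addKr; split=> //.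
  by apply: convex_coneD => //; apply: Scone.1 => //; rewrite invr_ge0 ltW.
have Tlin : linear (fun z => - g z *: k0).
  move=> t z w; rewrite linearP /= opprD scalerDl scalerA; congr (_ *: _ + _).
  by rewrite mulrN.
pose T : {linear Z -> Y} :=
  HB.pack (fun z => - g z *: k0) (GRing.isLinear.Build R Z Y *:%R _ Tlin).
have fT z : f (T z) = - g z by rewrite linear_formZ fk0 mulr1.
exists T.
  split.
    move=> z U /(@scale_continuous R Y (- g z, k0))[[A1 A2] /= [Ag Ak] AU].
    have gz : (fun z' => - g z' : R^o) @ z --> (- g z : R^o).
      by apply: (@cvgN _ R^o); exact: cg.
    have : \forall z' \near z, A1 (- g z') by exact: gz.
    apply: filterS => z' Az'; apply: (AU (- g z', k0)); split=> //=.
    exact: nbhs_singleton.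
  apply/eqP/negPn/negP => /set0P[_ [[s Ss <-] [k Kk kE]]].
  have := fT s; rewrite -kE linearN; have := fKint k Kk; have := gS s Ss; lra.
move=> x Cx [_ [_ [_ [s Ss <-] <-] [_ [k Kk <-] <-]]].
case Fx : (F x) => [v||]//; case Gx : (G x) => [w||]//= [qE].
have := fKint k Kk; have := gS s Ss.
have : f (T (- s) - k) = f (v + T w - L x + y) by rewrite qE.
have : g w <= f (v - L x + y).
  apply: (gM (_, _)); exists x; split=> //=; last by exists v.
  by apply/epiP; exists w, 0; rewrite addr0.
rewrite !linearD !linearN !fT linearN /=; lra.
Qed.
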